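(* Let $n\geq 1$, let $Q_{n-1}$ be a polynomial of degree at most $n-1$ satisfying conditions (i) and (ii) of the context, with nodes $x_{n,k}$, and let $R_n$ be the associated rational Bernstein operator. Then for all $x\in[0,1]$, with $e_2(x)=x^2$, $$\left|R_n(e_2)(x)-x^2\right|\leq \sup_{0\leq k\leq n-1}\left|x_{n,k+1}-x_{n,k}\right|\cdot x(1-x).$$
   Context: $C[0,1]$ is the space of continuous real-valued functions on $[0,1]$. Let $n\geq 1$ and let $Q_{n-1}$ be a polynomial of degree at most $n-1$, strictly positive on $[0,1]$. Write $Q_{n-1}(x)=\sum_{k=0}^{n-1}\gamma_{n-1,k}\,x^k(1-x)^{n-1-k}$ and $\gamma_{n-1,k}=w_{n-1,k}\binom{n-1}{k}$, so that the $w_{n-1,k}$ are the Bernstein coefficients of $Q_{n-1}$. Conditions: (i) $w_{n-1,k}>0$ for $k=0,\dots,n-1$; (ii) property (W): $\frac{w_{n-1,k-1}w_{n-1,k+1}}{w_{n-1,k}^2}<\frac{k+1}{k}\cdot\frac{n-k}{n-k-1}$ for $k=1,\dots,n-2$ (equivalently, $\gamma_{n-1,k-1}/\gamma_{n-1,k}$ is strictly increasing in $k=1,\dots,n-1$). Convention: $\gamma_{n-1,-1}=\gamma_{n-1,n}=0$. The nodes are $x_{n,k}=\frac{\gamma_{n-1,k-1}}{\gamma_{n-1,k}+\gamma_{n-1,k-1}}$ for $k=0,\dots,n$; under (i) and (ii) one has $0=x_{n,0}<x_{n,1}<\dots<x_{n,n}=1$. The rational Bernstein operator associated with $Q_{n-1}$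 is $$R_nf(x)=\sum_{k=0}^{n}f(x_{n,k})\,(\gamma_{n-1,k}+\gamma_{n-1,k-1})\,\frac{x^k(1-x)^{n-k}}{Q_{n-1}(x)},\qquad f\in C[0,1],$$ which reproduces the functions $1$ and $x$. *)

(* Defs.v *)
From HB Require Import structures.
From mathcomp Require Import all_boot all_order all_algebra.
From mathcomp Require Import classical_sets reals.

Set Implicit Arguments.
Unset Strict Implicit.
Unset Printing Implicit Defensive.

Import Order.TTheory GRing.Theory Num.Theory.

Local Open Scope ring_scope.

Section RationalBernstein.
Variable R : realType.
Implicit Types (n k : nat) (w : nat -> R) (Q : {poly R}) (f : R -> R) (x : R).

(* Throughout, n >= 1 and only w 0, ..., w (n - 1) matter: for n <= k the
   binomial 'C(n.-1, k) vanishes, which gives the convention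
   gamma_{n-1,n} = 0. *)
Definition bgamma n w k : R := w k * ('C(n.-1, k))%:R.

(* gamma_{n-1,k-1}, with the convention gamma_{n-1,-1} = 0. *)
Definition bgamma_pred n w k : R := if k is k'.+1 then bgamma n w k' else 0.

(* The Bernstein polynomials of degree n - 1 form a basis, so this determines
   w 0, ..., w (n - 1) from Q. *)
Definition bernstein_coefs n Q w : Prop :=
  Q = \sum_(k < n) bgamma n w k *: ('X^k * (1 - 'X) ^+ (n.-1 - k)).

Definition propertyW n w : Prop :=
  forall k, (1 <= k <= n - 2)%N ->
    w k.-1 * w k.+1 / w k ^+ 2
      < (k.+1%:R / k%:R) * ((n - k)%:R / (n - k - 1)%:R).

Definition bnode n w k : R :=
  bgamma_pred n w k / (bgamma n w k + bgamma_pred n w k).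

(* Only the values of f at the nodes enter, so functions on [0, 1] are
   represented by arbitrary extensions to R. *)
Definition rat_bernstein n Q w f x : R :=
  \sum_(k < n.+1) f (bnode n w k) * (bgamma n w k + bgamma_pred n w k)
                  * (x ^+ k * (1 - x) ^+ (n - k) / Q.[x]).

End RationalBernstein.

(* Main.v *)
Require Import Defs.
From HB Require Import structures.
From mathcomp Require Import all_boot all_order all_algebra.
From mathcomp Require Import classical_sets reals.
From mathcomp Require Import ring.

(** Put [y = 1 - x], [g k] for the [k]-th [bgamma] and [t k] for the [k]-th
    node.  The proof rests on the exact formula ([rat_bernstein_sqr_sub])

      [R_n e_2 x - x^2 = x y * \sum_(k < n) (t k.+1 - t k) (g k x^k y^(n-1-k) / Q x)].

    The numbers [g k x^k y^(n-1-k) / Q x] are nonnegative and add up to [1],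
    because [Q] is the sum of the numerators.  The sum is therefore a weighted
    mean of the gaps between consecutive nodes, and is bounded in absolute value
    by the largest one.

    The formula comes from [t k.+1 (g k + g k.+1) = g k], used twice.  Shifting
    the index by one in the definition of [R_n e_2 x] extracts a factor [x] and
    leaves the mean of [t k.+1 - x].  Writing
    [t k.+1 - x = t k.+1 y - (1 - t k.+1) x] and
    [g k (1 - t k.+1) = g k.+1 t k.+1], a second shift
    ([sum_bernstein_shift]) turns the last part into the mean of [t k] times
    [y], which extracts the factor [y]. *)

Set Implicit Arguments.
Unset Strict Implicit.
Unset Printing Implicit Defensive.

Import Order.TTheory GRing.Theory Num.Theory.

Local Open Scope classical_set_scope.
Local Open Scope ring_scope.

(** A finite family is bounded above by the sum of its absolute values, so its
    [sup] is meaningful. *)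
Lemma le_sup_initial_segment (R : realType) (n : nat) (a : nat -> R) (i : nat) :
  (i < n)%N -> a i <= sup [set a k | k in `I_n].
Proof.
move=> i_lt_n; apply: ub_le_sup; last by exists i.
exists (\sum_(k < n) `|a k|) => _ [j j_lt_n <-].
rewrite (bigD1 (Ordinal j_lt_n)) //= (le_trans (ler_norm _)) // lerDl.
exact: sumr_ge0.
Qed.

Lemma ler_norm_weighted_sum (R : numDomainType) (n : nat) (a p : 'I_n -> R)
    (M : R) :
  (forall k, `|a k| <= M) -> (forall k, 0 <= p k) ->
  `|\sum_(k < n) a k * p k| <= M * \sum_(k < n) p k.
Proof.
move=> aM p_ge0; rewrite mulr_sumr (le_trans (ler_norm_sum _ _ _)) //.
by apply: ler_sum => k _; rewrite normrM (ger0_norm (p_ge0 k)) ler_wpM2r.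
Qed.

(** Both sides are the degree [m.+1] form with coefficients [c], indexed from
    [1] to [m.+1] on the left and from [0] to [m] on the right.  Since the two
    end coefficients vanish, only the terms common to both ranges remain. *)
Lemma sum_bernstein_shift (R : comNzRingType) (m : nat) (c : nat -> R)
    (x y : R) :
  c 0 = 0 -> c m.+1 = 0 ->
  \sum_(k < m.+1) c k.+1 * (x ^+ k.+1 * y ^+ (m - k))
  = y * \sum_(k < m.+1) c k * (x ^+ k * y ^+ (m - k)).
Proof.
move=> c0 cm; rewrite big_ord_recr [in RHS]big_ord_recl /= c0 cm.
rewrite !mul0r addr0 add0r mulr_sumr; apply: eq_bigr => k _.
rewrite /bump /= add1n -(subnSK (ltn_ord k)) [y ^+ _.+1]exprS.
by rewrite [y * (c _ * _)]mulrCA [y * (x ^+ _ * _)]mulrCA.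
Qed.

Section Nodes.
Variables (R : realType) (m : nat) (w : nat -> R).
Hypothesis w_gt0 : forall k : nat, (k <= m)%N -> 0 < w k.

Let g := bgamma m.+1 w.
Let t := bnode m.+1 w.

Lemma bgamma_gt0 k : (k <= m)%N -> 0 < g k.
Proof. by move=> km; rewrite mulr_gt0 ?w_gt0 // ltr0n bin_gt0. Qed.

Lemma bgamma_last : g m.+1 = 0.
Proof. by rewrite /g /bgamma bin_small ?mulr0. Qed.

Lemma bnode0 : t 0 = 0.
Proof. by rewrite /t /bnode mul0r. Qed.

Lemma bnodeS k : (k <= m)%N -> t k.+1 * (g k.+1 + g k) = g k.
Proof.
move=> km; apply: divfK; apply/lt0r_neq0.
rewrite -/g ltr_wpDl ?bgamma_gt0 //.
move: km; rewrite leq_eqVlt => /predU1P[->|km]; first by rewrite bgamma_last.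
exact/ltW/bgamma_gt0.
Qed.

Lemma bnode_complement k : (k <= m)%N -> g k * (1 - t k.+1) = g k.+1 * t k.+1.
Proof. by move=> /bnodeS tk; rewrite mulrBr mulr1 -{1}tk; ring. Qed.

Variables (Q : {poly R}) (x : R).
Hypothesis Qw : bernstein_coefs m.+1 Q w.

Let p k := g k * (x ^+ k * (1 - x) ^+ (m - k)).

Lemma horner_bernstein : Q.[x] = \sum_(k < m.+1) p k.
Proof.
rewrite {1}Qw horner_sum; apply: eq_bigr => k _.
by rewrite hornerZ hornerM !horner_exp hornerD hornerN hornerX hornerC.
Qed.

Lemma rat_bernstein_sqr :
  rat_bernstein m.+1 Q w (fun s : R => s ^+ 2) x
  = x * (\sum_(k < m.+1) t k.+1 * p k) / Q.[x].
Proof.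
rewrite /rat_bernstein big_ord_recl /= -/t bnode0 expr0n !mul0r add0r.
rewrite mulr_sumr mulr_suml; apply: eq_bigr => k _.
rewrite /bump /= add1n add0n subSS -/g -/t /p [x ^+ _.+1]exprS.
by have km := ltn_ord k; rewrite -[g k in RHS](bnodeS km); ring.
Qed.

(** The part of the mean of [t k.+1 - x] that lacks a factor [1 - x] acquires
    one from [sum_bernstein_shift], applied to the products [g k * t k]. *)
Lemma sum_bnode_sub :
  \sum_(k < m.+1) (t k.+1 - x) * p k
  = (1 - x) * \sum_(k < m.+1) (t k.+1 - t k) * p k.
Proof.
have gt0 : g 0 * t 0 = 0 by rewrite bnode0 mulr0.
have gtm : g m.+1 * t m.+1 = 0 by rewrite bgamma_last mul0r.
have shift :=
  @sum_bernstein_shift R m (fun k => g k * t k) x (1 - x) gt0 gtm.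
transitivity ((1 - x) * \sum_(k < m.+1) t k.+1 * p k
    - \sum_(k < m.+1) g k.+1 * t k.+1 * (x ^+ k.+1 * (1 - x) ^+ (m - k))).
  rewrite mulr_sumr -sumrB; apply: eq_bigr => k _.
  have km := ltn_ord k; rewrite -(bnode_complement km) /p exprS; ring.
rewrite shift -mulrBr -sumrB; congr (_ * _); apply: eq_bigr => k _.
by rewrite /p; ring.
Qed.

Lemma rat_bernstein_sqr_sub : Q.[x] != 0 ->
  rat_bernstein m.+1 Q w (fun s : R => s ^+ 2) x - x ^+ 2
  = (\sum_(k < m.+1) (t k.+1 - t k) * p k) / Q.[x] * (x * (1 - x)).
Proof.
move=> Qx_neq0.
transitivity (x * (\sum_(k < m.+1) (t k.+1 - x) * p k) / Q.[x]); last first.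
  by rewrite sum_bnode_sub; ring.
have -> : \sum_(k < m.+1) (t k.+1 - x) * p k
          = \sum_(k < m.+1) t k.+1 * p k - x * Q.[x].
  rewrite horner_bernstein mulr_sumr -sumrB.
  by apply: eq_bigr => k _; rewrite mulrBl.
by rewrite rat_bernstein_sqr mulrBr mulrBl mulrA mulfK.
Qed.

End Nodes.

Theorem corollary4 (R : realType) (n : nat) (Q : {poly R}) (w : nat -> R)
  (n_ge1 : (1 <= n)%N)
  (degQ : (size Q <= n)%N)
  (Q_gt0 : forall x : R, 0 <= x <= 1 -> 0 < Q.[x])
  (Qw : bernstein_coefs n Q w)
  (w_gt0 : forall k : nat, (k <= n - 1)%N -> 0 < w k)
  (wW : propertyW n w) (x : R) (x01 : 0 <= x <= 1) :
  `| rat_bernstein n Q w (fun t : R => t ^+ 2) x - x ^+ 2 |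
    <= sup [set `| bnode n w k.+1 - bnode n w k | | k in `I_n]
       * (x * (1 - x)).
Proof.
case: n n_ge1 degQ Qw w_gt0 wW => // m _ _ Qw.
rewrite subn1 /= => w_gt0 _.
have Qx_gt0 := Q_gt0 _ x01; case/andP: x01 => x_ge0 x_le1.
have y_ge0 : 0 <= 1 - x by rewrite subr_ge0.
rewrite (rat_bernstein_sqr_sub w_gt0 Qw) ?lt0r_neq0 //.
rewrite normrM (ger0_norm (mulr_ge0 x_ge0 y_ge0)).
apply: ler_wpM2r; first exact: mulr_ge0.
rewrite normrM normfV (gtr0_norm Qx_gt0) ler_pdivrMr //.
rewrite [in leRHS](horner_bernstein x Qw); apply: ler_norm_weighted_sum => k.
  exact: (le_sup_initial_segment
    (fun k => `|bnode m.+1 w k.+1 - bnode m.+1 w k|) (ltn_ord k)).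
apply: mulr_ge0; last by rewrite mulr_ge0 ?exprn_ge0.
exact/ltW/(bgamma_gt0 w_gt0)/(ltn_ord k).
Qed.
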